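(* Let $n\ge 2$, let $q_1,\dots,q_n>0$, and let $E=\{x\in\mathbb{R}^n : \sum_{i=1}^n q_i^2x_i^2\le 1\}$. Then $$\frac{V_{n-1}(\partial E)}{V_n(E)} = n\,\frac{1}{\sigma(\mathbb{S}^{n-1})}\int_{\mathbb{S}^{n-1}}\sqrt{\sum_{i=1}^n u_i^2q_i^2}\;d\sigma(u).$$
   Context: $V_n(E)$ is the $n$-dimensional volume of $E$ and $V_{n-1}(\partial E)$ is the $(n-1)$-dimensional surface area of its boundary. $\mathbb{S}^{n-1}$ is the unit sphere in $\mathbb{R}^n$ and $\sigma$ its standard surface area measure. The semiaxes of $E$ have lengths $1/q_1,\dots,1/q_n$. *)

(* Defs.v *)
From HB Require Import structures.
From mathcomp Require Import all_boot all_order all_algebra.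
From mathcomp Require Import all_classical all_reals all_analysis.

Set Implicit Arguments.
Unset Strict Implicit.
Unset Printing Implicit Defensive.

Import Order.TTheory GRing.Theory Num.Theory.
Import numFieldNormedType.Exports.

Local Open Scope classical_set_scope.
Local Open Scope ring_scope.

Fact measure_rV_display : measure_display.
Proof. exact: default_measure_display. Qed.

(** 'rV[R]_n carries the sigma-algebra generated by the coordinates (the same
    construction as for n.-tuple T); it is the Borel sigma-algebra of R^n. *)
Section measurable_rV.
Context {R : realType} (n : nat).

Definition rV_coord (i : 'I_n) (x : 'rV[R]_n) : measurableTypeR R := x 0 i.

Let rV_set0 : g_sigma_preimage rV_coord set0.
Proof. exact: sigma_algebra0. Qed.

Let rV_setC A : g_sigma_preimage rV_coord A -> g_sigma_preimage rV_coord (~` A).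
Proof. exact: sigma_algebraC. Qed.

Let rV_bigcup (F : (set 'rV[R]_n)^nat) :
  (forall i, g_sigma_preimage rV_coord (F i)) ->
  g_sigma_preimage rV_coord (\bigcup_i (F i)).
Proof. exact: sigma_algebra_bigcup. Qed.

HB.instance Definition _ := @isMeasurable.Build measure_rV_display
  'rV[R]_n (g_sigma_preimage rV_coord) rV_set0 rV_setC rV_bigcup.

Lemma measurable_rV_coord i : measurable_fun [set: 'rV[R]_n] (rV_coord i).
Proof.
move=> _ B mB; apply: sub_sigma_algebra.
by rewrite (bigD1 i)//=; left; exists B.
Qed.

Lemma measurable_fun_rV d (T : measurableType d) (f : T -> 'rV[R]_n) :
  (forall i, measurable_fun [set: T] (rV_coord i \o f)) ->
  measurable_fun [set: T] f.
Proof.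
move=> mf _ A mA.
have sub : g_sigma_preimage (fun i => rV_coord i \o f) `<=` measurable.
  apply: smallest_sub; first exact: sigma_algebra_measurable.
  apply: (big_ind (fun S => S `<=` measurable)) => //.
    by move=> S1 S2 h1 h2 B []; [exact: h1|exact: h2].
  by move=> i _ _ [B mB <-]; exact: mf.
by apply: sub; rewrite g_sigma_preimage_comp; exists A.
Qed.

End measurable_rV.

Section lebesgue_rV.
Context {R : realType}.

Definition rV_cons n (xv : measurableTypeR R * 'rV[R]_n) : 'rV[R]_n.+1 :=
  \row_i oapp (xv.2 0) xv.1 (unlift ord0 i).

Definition rV_uncons n (x : 'rV[R]_n.+1) : measurableTypeR R * 'rV[R]_n :=
  (x 0 ord0, \row_i x 0 (lift ord0 i)).

Lemma rV_consK n : cancel (@rV_cons n) (@rV_uncons n).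
Proof.
move=> [x v]; rewrite /rV_uncons mxE unlift_none /=; congr pair.
by apply/rowP => i; rewrite !mxE liftK.
Qed.

Lemma measurable_rV_cons n : measurable_fun [set: _] (@rV_cons n).
Proof.
apply: measurable_fun_rV => i.
case: (unliftP ord0 i) => [j ->|->].
- rewrite (_ : _ \o _ = rV_coord j \o snd); last first.
    by apply/funext => xv /=; rewrite /rV_coord mxE liftK.
  exact: measurableT_comp (@measurable_rV_coord R n j) measurable_snd.
- rewrite (_ : _ \o _ = fst); first exact: measurable_fst.
  by apply/funext => xv /=; rewrite /rV_coord mxE unlift_none.
Qed.

Lemma measurable_rV_uncons n : measurable_fun [set: _] (@rV_uncons n).
Proof.
apply: measurable_fun_pair => /=.
  exact: (@measurable_rV_coord R n.+1 ord0).
apply: measurable_fun_rV => i.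
rewrite (_ : _ \o _ = @rV_coord R n.+1 (lift ord0 i)).
  exact: measurable_rV_coord.
by apply/funext => x /=; rewrite /rV_coord mxE.
Qed.

Definition lebesgue_rV_step n (mu : {sigma_finite_measure set 'rV[R]_n -> \bar R})
    : set 'rV[R]_n.+1 -> \bar R :=
  pushforward (@lebesgue_measure R \x mu)%E (@rV_cons n).

Section lebesgue_rV_step_measure.
Context n (mu : {sigma_finite_measure set 'rV[R]_n -> \bar R}).

Let measurable_preimage_rV_cons A : measurable A -> measurable (@rV_cons n @^-1` A).
Proof. by move=> mA; rewrite -[X in measurable X]setTI; exact: measurable_rV_cons. Qed.

Let lebesgue_rV_step0 : lebesgue_rV_step mu set0 = 0%E.
Proof. by rewrite /lebesgue_rV_step /pushforward preimage_set0 measure0. Qed.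

Let lebesgue_rV_step_ge0 A : (0 <= lebesgue_rV_step mu A)%E.
Proof. by rewrite /lebesgue_rV_step /pushforward; exact: measure_ge0. Qed.

Let lebesgue_rV_step_sigma_additive : semi_sigma_additive (lebesgue_rV_step mu).
Proof.
move=> F mF tF mUF; rewrite /lebesgue_rV_step /pushforward preimage_bigcup.
apply: measure_semi_sigma_additive.
- by move=> k; exact: measurable_preimage_rV_cons.
- apply/trivIsetP => /= i j _ _ ij; rewrite -preimage_setI.
  by move/trivIsetP : tF => /(_ _ _ _ _ ij) ->//; rewrite preimage_set0.
- by rewrite -preimage_bigcup; exact: measurable_preimage_rV_cons.
Qed.

HB.instance Definition _ := isMeasure.Build _ _ _ (lebesgue_rV_step mu)
  lebesgue_rV_step0 lebesgue_rV_step_ge0 lebesgue_rV_step_sigma_additive.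

Let lebesgue_rV_step_sigma_finite : sigma_finite setT (lebesgue_rV_step mu).
Proof.
have /sigma_finiteP[F [TF ndF Foo]] := sigma_finiteT (@lebesgue_measure R).
have /sigma_finiteP[G [TG ndG Goo]] := sigma_finiteT mu.
exists (fun k => @rV_uncons n @^-1` (F k `*` G k)).
  rewrite -preimage_bigcup (_ : \bigcup_k _ = setT)//.
  rewrite -subTset => -[x y] _.
  have [i _ Fx] : (\bigcup_k F k) x by rewrite -TF.
  have [j _ Gy] : (\bigcup_k G k) y by rewrite -TG.
  exists (maxn i j) => //; split.
  - by move: x Fx; exact/subsetPset/ndF/leq_maxl.
  - by move: y Gy; exact/subsetPset/ndG/leq_maxr.
move=> k; have [mF Fk] := Foo k; have [mG Gk] := Goo k; split.
  rewrite -[X in measurable X]setTI.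
  by apply: measurable_rV_uncons => //; exact: measurableX.
rewrite /lebesgue_rV_step /pushforward -comp_preimage.
rewrite (_ : _ \o _ = id); last by apply/funext => x; exact: rV_consK.
rewrite preimage_id.
by rewrite product_measure1E// lte_mul_pinfty// ge0_fin_numE.
Qed.

HB.instance Definition _ := Measure_isSigmaFinite.Build _ _ _
  (lebesgue_rV_step mu) lebesgue_rV_step_sigma_finite.

End lebesgue_rV_step_measure.

(** n-dimensional Lebesgue measure on R^n, as an iterated product. *)
Fixpoint lebesgue_rV n : {sigma_finite_measure set 'rV[R]_n -> \bar R} :=
  match n with
  | 0 => \d_(0 : 'rV[R]_0)
  | m.+1 => lebesgue_rV_step (lebesgue_rV m)
  end.

End lebesgue_rV.
Arguments lebesgue_rV {R} n.

Section surface_measure.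
Context {R : realType}.

Definition boundary (T : topologicalType) (A : set T) : set T :=
  closure A `\` interior A.

(** Injective regular C^1 parametrization, with parameter domain U open in R^k,
    of a piece of M. *)
Definition regular_param k n (M : set 'rV[R]_n) (U : set 'rV[R]_k)
    (phi : 'rV[R]_k -> 'rV[R]_n) : Prop :=
  [/\ open U,
      forall y, U y -> differentiable phi y,
      forall y, U y -> {for y, continuous (jacobian phi)},
      forall y, U y -> row_free (jacobian phi y) &
      set_inj U phi /\ phi @` U `<=` M].

(** The matrix [jacobian phi y] acts on row vectors, hence its rows are the
    partial derivatives of phi and [J *m J^T] is their Gram matrix. *)
Definition area_density k n (phi : 'rV[R]_k -> 'rV[R]_n) (y : 'rV[R]_k) : R :=
  Num.sqrt (\det (jacobian phi y *m (jacobian phi y)^T)).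

(** [mu] is the k-dimensional surface area measure of the C^1 submanifold M of
    R^n, seen as a measure on R^n carried by M: the area of a parametrized piece
    is the integral of the square root of the Gram determinant. This determines
    [mu] as soon as M is covered by countably many regular parametrizations. *)
Definition is_surface_measure k n (M : set 'rV[R]_n)
    (mu : {measure set 'rV[R]_n -> \bar R}) : Prop :=
  mu (~` M) = 0%E /\
  forall (U : set 'rV[R]_k) (phi : 'rV[R]_k -> 'rV[R]_n),
    regular_param M U phi ->
    forall A : set 'rV[R]_k, measurable A -> A `<=` U ->
      mu (phi @` A) = (\int[lebesgue_rV k]_(y in A) (area_density phi y)%:E)%E.

Definition unit_sphere n : set 'rV[R]_n :=
  [set u | \sum_(i < n) u 0 i ^+ 2 = 1].

Definition ellipsoid n (q : 'I_n -> R) : set 'rV[R]_n :=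
  [set x | \sum_(i < n) q i ^+ 2 * x 0 i ^+ 2 <= 1].

End surface_measure.
Arguments unit_sphere {R} n.

(* Main.v *)
Require Import Defs.
From HB Require Import structures.
From mathcomp Require Import all_boot all_order all_algebra.
From mathcomp Require Import all_classical all_reals all_analysis.
From mathcomp Require Import measurable_realfun.
From mathcomp Require Import ring lra.

(** Write [Q = sum q_i^2 x_i^2] and parametrize the half [s x_i > 0] of [Q = 1]
    by the graph [y |-> (s sqrt (1 - |y|^2), y)] of the unit sphere followed by
    the scaling [x_j |-> x_j / q_j]. By the matrix determinant lemma its area
    density is [sqrt (sum q_j^2 u_j^2) / (prod q_j sqrt (1 - |y|^2))], where [u]
    is the point of the sphere above [y]. The two halves [s = 1, -1] for [i = 0]
    miss only [x_0 = 0], which is null as seen in the charts with [i <> 0]. Hence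
    the area of the boundary is [(prod q_j)^-1] times the integral of
    [sqrt (sum u_j^2 q_j^2)] over the sphere, while the volume of the ellipsoid
    is [(prod q_j)^-1] times that of the unit ball [B]. It remains to see that
    the area of the sphere is [n vol(B)], i.e. that the integral of
    [1 / sqrt (1 - |y|^2)] is [n] times that of [sqrt (1 - |y|^2)]. *)

Set Implicit Arguments.
Unset Strict Implicit.
Unset Printing Implicit Defensive.

Import Order.TTheory GRing.Theory Num.Theory.
Import numFieldNormedType.Exports.

Local Open Scope classical_set_scope.
Local Open Scope ring_scope.

(** * Change of variables with a density, for nonnegative functions *)

Section transfer_density.
Local Open Scope ereal_scope.
Context (d1 d2 : measure_display) (T1 : measurableType d1)
  (T2 : measurableType d2) (R : realType).
Variables (mu : {measure set T1 -> \bar R}) (nu : {measure set T2 -> \bar R}).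
Variables (phi : T1 -> T2) (g : T1 -> R) (U : set T1) (D : set T2).
Hypotheses (mphi : measurable_fun [set: T1] phi).
Hypotheses (mg : measurable_fun [set: T1] g) (g0 : forall y, (0 <= g y)%R).
Hypotheses (mU : measurable U) (mD : measurable D).
Hypothesis nuE : forall B, measurable B ->
  nu (D `&` B) = \int[mu]_(y in U `&` phi @^-1` B) (g y)%:E.

Import HBNNSimple.

(** [nuE] is the case of indicator functions. It extends to simple functions by linearity and then
    to [f] by monotone convergence on both sides, along the same approximating sequence [h]. *)
Lemma ge0_integral_transfer_density (f : T2 -> \bar R) :
  measurable_fun [set: T2] f -> (forall x, 0 <= f x) ->
  \int[nu]_(x in D) f x = \int[mu]_(y in U) (f (phi y) * (g y)%:E).
Proof.
move=> mf f0; pose h := nnsfun_approx measurableT mf.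
have mge : measurable_fun U (EFin \o g).
  by apply: measurable_funTS; exact/measurable_EFinP.
have mhphi n : measurable_fun U (fun y => (h n (phi y))%:E).
  by apply: measurable_funTS; apply/measurable_EFinP; exact: measurableT_comp.
have -> : \int[nu]_(x in D) f x =
    lim (\int[nu]_(x in D) (EFin \o h n) x @[n --> \oo]).
  have fE x : f x = lim ((EFin \o h n) x @[n --> \oo]).
    by apply/esym/cvg_lim => //; exact: cvg_nnsfun_approx.
  under eq_integral do rewrite fE.
  apply: monotone_convergence => //.
  - move=> n; apply/measurable_EFinP; apply: measurable_funTS.
    exact/measurable_funP.
  - by move=> n x _ /=; rewrite lee_fin.
  - by move=> x _ a b ab; rewrite lee_fin; exact/lefP/nd_nnsfun_approx.
have -> : \int[mu]_(y in U) (f (phi y) * (g y)%:E) =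
    lim (\int[mu]_(y in U) ((h n (phi y))%:E * (g y)%:E) @[n --> \oo]).
  have fE y : f (phi y) * (g y)%:E =
      lim ((h n (phi y))%:E * (g y)%:E @[n --> \oo]).
    apply/esym/cvg_lim => //; apply: cvgeZr => //.
    exact: (@cvg_nnsfun_approx _ _ _ _ _ _ mf).
  under eq_integral do rewrite fE.
  apply: monotone_convergence => //.
  - by move=> n; apply: emeasurable_funM.
  - by move=> n x _ /=; rewrite mule_ge0 ?lee_fin.
  - move=> x _ a b ab; rewrite lee_wpmul2r ?lee_fin//.
    exact/lefP/nd_nnsfun_approx.
(* Only simple functions remain; [h n] is split over its finite range into multiples of indicators
   of level sets. *)
suff suf n : \int[nu]_(x in D) (EFin \o h n) x =
    \int[mu]_(y in U) ((h n (phi y))%:E * (g y)%:E).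
  by under eq_fun do rewrite suf.
transitivity (\int[nu]_(x in D)
   (\sum_(y \in range (h n)) (y * \1_(h n @^-1` [set y]) x)%:E)).
  by apply: eq_integral => t tE; rewrite /= fimfunE -fsumEFin.
have mindic m r : measurable_fun D (fun x => (r * \1_(h m @^-1` [set r]) x)%:E).
  by apply: (measurable_comp measurableT) => //; exact: measurable_funM.
have mh r : measurable (h n @^-1` [set r]) by [].
have mindicphi r : measurable_fun U
    (fun x => (\1_(h n @^-1` [set r]) (phi x))%:E : \bar R).
  apply: measurable_funTS; apply/measurable_EFinP.
  by apply: measurableT_comp => //; exact: measurable_indic.
rewrite ge0_integral_fsum//; last by move=> m y Ey; exact: nnfun_muleindic_ge0.
transitivity (\int[mu]_(x in U) (\sum_(y \in range (h n))
    (y * \1_(h n @^-1` [set y]) (phi x))%:E * (g x)%:E)); last first.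
  apply: eq_integral => x xE.
  rewrite -ge0_mule_fsuml => [|y]; last exact: nnfun_muleindic_ge0.
  by rewrite fsumEFin // -(fimfunE _ (phi x)).
rewrite ge0_integral_fsum//; last 2 first.
  - move=> y; under eq_fun do rewrite EFinM -muleA.
    by apply: measurable_funeM; apply: emeasurable_funM.
  - by move=> m y _; rewrite mule_ge0// ?lee_fin//; exact: nnfun_muleindic_ge0.
apply: eq_fsbigr => r rhn.
have r0 : (0 <= r)%R by move: rhn; rewrite inE => -[t _ <-].
under eq_integral do rewrite EFinM.
rewrite integralZl_indic_nnsfun => //.
under [RHS]eq_integral do rewrite EFinM -muleA.
rewrite ge0_integralZl//; last 2 first.
- by apply: emeasurable_funM.
- by move=> t _; rewrite mule_ge0 ?lee_fin.
(* The two sides now differ only in form: restricting the domain to the preimage of the level set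
   amounts to multiplying by its indicator. *)
rewrite integral_indic// setIC nuE//.
rewrite integral_mkcondr; congr (_ * _); apply: eq_integral => x _.
rewrite /patch /= indicE; case: ifPn => xr.
  by rewrite mem_set ?mul1e//; exact: set_mem xr.
by rewrite memNset ?mul0e// => xr'; move/negP: xr; apply; exact: mem_set.
Qed.

End transfer_density.

(** * Image measures *)

Section image_measure.
Context (d1 d2 : measure_display) (T1 : measurableType d1)
  (T2 : measurableType d2) (R : realType).
Variables (mu : {measure set T1 -> \bar R}) (phi : T1 -> T2).
Hypothesis mphi : measurable_fun [set: T1] phi.

(* The instance takes the measurability of [phi] as an argument, which
   unification cannot provide. *)
Definition image_measure : {measure set T2 -> \bar R} :=
  measure_function_pushforward__canonical__measure_function_Measure mu mphi.

End image_measure.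

(** * Lebesgue measure under diagonal scalings, on hyperplanes and on cubes *)

Section lebesgue_scaling.
Context {R : realType}.
Local Open Scope ereal_scope.

(** By uniqueness of Lebesgue measure: [c] times its image under [x |-> c * x] gives each interval
    []a, b]] its length. *)
Lemma lebesgue_measure_preimage_scale (c : R) (A : set (measurableTypeR R)) :
  (0 < c)%R -> measurable A ->
  lebesgue_measure ((fun x => c * x)%R @^-1` A) = c^-1%:E * lebesgue_measure A.
Proof.
move=> c0 mA.
have mc : measurable_fun [set: measurableTypeR R]
    ((fun x => c * x)%R : _ -> measurableTypeR R).
  exact: mulrl_measurable.
have c0' : (0 <= c)%R by exact: ltW.
have -> : lebesgue_measure A = mscale (NngNum c0')
    (image_measure (@lebesgue_measure R) mc) A.
  apply: lebesgue_measure_unique => // X [[a b] _ <-] /=.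
  rewrite /mscale/= /pushforward/=.
  have -> : (fun x => c * x)%R @^-1` `]a, b] = `](a / c)%R, (b / c)%R]%classic.
    apply/seteqP; split => x /=;
      by rewrite !in_itv/= ltr_pdivrMr// ler_pdivlMr// mulrC.
  rewrite !lebesgue_measure_itv/= !lte_fin ltr_pM2r ?invr_gt0//.
  case: ifPn; last by rewrite mule0.
  by rewrite -!EFinB -EFinM -mulrBl mulrC divfK ?gt_eqF.
by rewrite /mscale/= muleA -EFinM mulVf ?gt_eqF// mul1e.
Qed.

Lemma ge0_integral_lebesgue_scale (c : R) (f : measurableTypeR R -> \bar R) :
  (0 < c)%R -> measurable_fun [set: measurableTypeR R] f ->
  (forall x, 0 <= f x) ->
  \int[lebesgue_measure]_x f (c * x)%R =
  c^-1%:E * \int[lebesgue_measure]_x f x.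
Proof.
move=> c0 mf f0.
have mc : measurable_fun [set: measurableTypeR R]
    ((fun x => c * x)%R : _ -> measurableTypeR R).
  exact: mulrl_measurable.
have c0' : (0 <= c^-1)%R by rewrite invr_ge0 ltW.
have := @ge0_integral_pushforward _ _ _ _ R _ mc (@lebesgue_measure R) setT f
  measurableT mf (fun x _ => f0 x).
rewrite preimage_setT => <-.
rewrite (eq_measure_integral (mscale (NngNum c0') (@lebesgue_measure R))).
  by rewrite ge0_integral_mscale.
by move=> A mA _; exact: lebesgue_measure_preimage_scale.
Qed.

Definition rV_scale n (d : 'I_n -> R) (x : 'rV[R]_n) : 'rV[R]_n :=
  (\row_i (d i * x 0%R i))%R.

Lemma measurable_rV_scale n (d : 'I_n -> R) :
  measurable_fun [set: 'rV[R]_n] (rV_scale d).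
Proof.
apply: measurable_fun_rV => i.
rewrite (_ : _ \o _ = (fun x => d i * rV_coord i x)%R); last first.
  by apply/funext => x /=; rewrite /rV_coord mxE.
apply: (measurable_funM (measurable_cst _)).
exact: measurable_rV_coord.
Qed.

Lemma rV_scale_cons n (d : 'I_n.+1 -> R) t (y : 'rV[R]_n) :
  rV_scale d (rV_cons (t, y)) =
  rV_cons ((d ord0 * t)%R, rV_scale (fun i => d (lift ord0 i)) y).
Proof.
apply/rowP => i; rewrite !mxE; case: unliftP => [j ->|->] /=.
  by rewrite mxE.
by [].
Qed.

(** Induction on the dimension by slicing along the first coordinate: the slice of the preimage at
    [x] is the preimage, under the remaining scalings, of the slice of [A] at [d ord0 * x]. The
    one-dimensional substitution then supplies the last factor. *)
Lemma lebesgue_rV_preimage_scale n (d : 'I_n -> R) (A : set 'rV[R]_n) :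
  (forall i, 0 < d i)%R -> measurable A ->
  lebesgue_rV n (rV_scale d @^-1` A) =
  ((\prod_i d i)^-1)%:E * lebesgue_rV n A.
Proof.
elim: n d A => [|n IH] d A d0 mA.
  rewrite big_ord0 invr1 mul1e; congr (lebesgue_rV 0 _).
  by apply/seteqP; split => x /=; rewrite (_ : rV_scale d x = x)//;
    apply/rowP => -[].
rewrite big_ord_recl.
pose d' i := d (lift ord0 i).
have d'0 i : (0 < d' i)%R by exact: d0.
have P0 : (0 <= \prod_i d' i)%R by apply: prodr_ge0 => i _; exact: ltW.
rewrite /= /lebesgue_rV_step /pushforward /= /product_measure1 /=.
set B := @rV_cons R n @^-1` A.
have mB : measurable B.
  by rewrite /B -[X in measurable X]setTI; exact: measurable_rV_cons.
have mBx x : measurable (xsection B x) by exact: measurable_xsection.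
transitivity (\int[lebesgue_measure]_x
    (((\prod_i d' i)^-1)%:E * lebesgue_rV n (xsection B (d ord0 * x)%R))).
  apply: eq_integral => x _ /=.
  rewrite -IH//; congr (lebesgue_rV n _).
  apply/seteqP; split => y /=; rewrite /xsection/= !inE /B/= rV_scale_cons//.
rewrite ge0_integralZl//=; last 2 first.
- by apply: (measurableT_comp (measurable_fun_xsection (lebesgue_rV n) mB));
    exact: mulrl_measurable.
- by rewrite lee_fin invr_ge0.
rewrite (@ge0_integral_lebesgue_scale _
  (fun x => lebesgue_rV n (xsection B x)))//.
- by rewrite muleA -EFinM invfM [(_^-1 * _)%R]mulrC.
- exact: measurable_fun_xsection.
Qed.

Lemma ge0_integral_lebesgue_rV_scale n (d : 'I_n -> R) (f : 'rV[R]_n -> \bar R) :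
  (forall i, 0 < d i)%R -> measurable_fun [set: 'rV[R]_n] f ->
  (forall x, 0 <= f x) ->
  \int[lebesgue_rV n]_x f (rV_scale d x) =
  ((\prod_i d i)^-1)%:E * \int[lebesgue_rV n]_x f x.
Proof.
move=> d0 mf f0.
have mc := measurable_rV_scale d.
have P0 : (0 <= (\prod_i d i)^-1)%R.
  by rewrite invr_ge0; apply: prodr_ge0 => i _; exact: ltW.
have := @ge0_integral_pushforward _ _ _ _ R _ mc (lebesgue_rV n) setT f
  measurableT mf (fun x _ => f0 x).
rewrite preimage_setT => <-.
rewrite (eq_measure_integral (mscale (NngNum P0) (lebesgue_rV n))).
  by rewrite ge0_integral_mscale.
by move=> A mA _; exact: lebesgue_rV_preimage_scale.
Qed.

Lemma lebesgue_rV_preimage_uncons n (A : set (measurableTypeR R)) (B : set 'rV[R]_n) :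
  measurable A -> measurable B ->
  lebesgue_rV n.+1 (@rV_uncons R n @^-1` (A `*` B)) =
  lebesgue_measure A * lebesgue_rV n B.
Proof.
move=> mA mB; rewrite /= /lebesgue_rV_step /pushforward -comp_preimage.
rewrite (_ : _ \o _ = id); last by apply/funext => x; exact: rV_consK.
by rewrite preimage_id product_measure1E.
Qed.

(** The hyperplane is a product with a null factor: the point 0 if [j] is the first index, a
    hyperplane of lower dimension otherwise. The other factor may have infinite measure, since
    [0 * +oo = 0]. *)
Lemma lebesgue_rV_hyperplane n (j : 'I_n) :
  lebesgue_rV n [set x : 'rV[R]_n | x 0%R j = 0%R] = 0.
Proof.
elim: n j => [[]//|n IH] j.
have [j' ->|->] := unliftP ord0 j.
  rewrite (_ : [set _ | _] = @rV_uncons R n @^-1` (setT `*` [set x : 'rV[R]_n | x 0%R j' = 0%R])).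
    rewrite lebesgue_rV_preimage_uncons//; first by rewrite IH mule0.
    rewrite (_ : [set _ | _] = rV_coord j' @^-1` [set 0%R])//.
    by rewrite -[X in measurable X]setTI; exact: measurable_rV_coord.
  by apply/seteqP; split => x /=; rewrite mxE => // -[].
rewrite (_ : [set _ | _] = @rV_uncons R n @^-1` ([set 0%R] `*` setT)).
  by rewrite lebesgue_rV_preimage_uncons//= lebesgue_measure_set1 mul0e.
by apply/seteqP; split => x //= [].
Qed.

Lemma measurable_cube n (r : R) :
  measurable [set x : 'rV[R]_n | forall i, `|x 0%R i| <= r]%R.
Proof.
rewrite (_ : [set _ | _] = \bigcap_(i in [set: 'I_n]) (rV_coord i @^-1` [set` `[- r, r]%R])).
  apply: fin_bigcap_measurable => // i _.
  rewrite -[X in measurable X]setTI; exact: measurable_rV_coord.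
apply/seteqP; split => x /=.
  by move=> xr i _ /=; rewrite in_itv/= -ler_norml; exact: xr.
by move=> xr i; have /= := xr i Logic.I; rewrite in_itv/= -ler_norml.
Qed.

(** Cubes inside and around the unit ball will show that its volume is positive and finite. *)
Lemma lebesgue_rV_cube n (r : R) : (0 < r)%R ->
  lebesgue_rV n [set x : 'rV[R]_n | forall i, `|x 0%R i| <= r]%R = ((2 * r) ^+ n)%:E.
Proof.
move=> r0; elim: n => [|n IH].
  rewrite expr0 /= /dirac /= indicE mem_set//; by case.
have mcube := @measurable_cube n r.
rewrite (_ : [set _ | _] = @rV_uncons R n @^-1` ([set` `[- r, r]%R] `*`
    [set x : 'rV[R]_n | forall i, `|x 0%R i| <= r]%R)).
  rewrite lebesgue_rV_preimage_uncons// IH lebesgue_measure_itv/= lte_fin gtrN//.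
  by rewrite -EFinD -EFinM opprK -mulr2n -[(r *+ 2)%R]mulr_natl exprS.
apply/seteqP; split => x /=.
  by move=> xr; split; rewrite /= ?in_itv/= -?ler_norml// => i; rewrite mxE.
rewrite in_itv/= -ler_norml => -[x0 xr] i.
by have [j ->|->//] := unliftP ord0 i; have := xr j; rewrite mxE.
Qed.

End lebesgue_scaling.

(** * Continuity and differentials of matrix maps; a determinant identity *)

Section matrix_calculus.
Context {R : realType}.

Lemma continuous_at_mx (T : topologicalType) m n (f : T -> 'M[R]_(m, n)) x :
  (forall i j, {for x, continuous (fun y => f y i j)}) -> {for x, continuous f}.
Proof.
move=> cf A [P fxP PA]; rewrite nbhs_filterE.
have : \forall y \near x, forall i j, P i j (f y i j).
  apply: filter_forall => i; apply: filter_forall => j.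
  exact: cf (fxP i j).
by apply: filterS => y Py; exact: PA.
Qed.

Lemma continuous_at_sum (T : topologicalType) (I : Type) (r : seq I)
    (f : I -> T -> R) x :
  (forall i, {for x, continuous (f i)}) ->
  {for x, continuous (fun y => \sum_(i <- r) f i y)}.
Proof.
move=> cf; elim: r => [|i r IH].
  rewrite (_ : (fun _ => _) = cst 0); first exact: cst_continuous.
  by apply/funext => y; rewrite big_nil.
rewrite (_ : (fun _ => _) = f i \+ (fun y => \sum_(j <- r) f j y)).
  exact: continuousD (cf i) IH.
by apply/funext => y; rewrite big_cons.
Qed.

Lemma mulmxr_continuous k m n (A : 'M[R]_(m, n)) :
  continuous (fun y : 'M[R]_(k, m) => y *m A).
Proof.
move=> y; apply: continuous_at_mx => i j.
rewrite (_ : (fun _ => _) = fun z : 'M[R]_(k, m) => \sum_l z i l * A l j); last first.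
  by apply/funext => z; rewrite mxE.
apply: continuous_at_sum => l; apply: continuousM; last exact: cst_continuous.
exact: coord_continuous.
Qed.

Lemma is_diff_mulmxr k m n (A : 'M[R]_(m, n)) (y : 'M[R]_(k, m)) :
  is_diff y (fun z => z *m A) (fun z => z *m A).
Proof.
apply: DiffDef.
  exact: (linear_differentiable (f := mulmxr A)) (@mulmxr_continuous k m n A).
exact: (diff_lin (f := mulmxr A)) (@mulmxr_continuous k m n A).
Qed.

Lemma is_diff_coord m n (i : 'I_m) (j : 'I_n) (y : 'M[R]_(m, n)) :
  is_diff y (fun z => z i j) (fun z => z i j).
Proof.
apply: DiffDef; first exact: differentiable_coord.
have @f : {linear 'M[R]_(m, n) -> R}.
  by exists (fun N : 'M[R]_(_, _) => N i j); do 2![eexists]; do ?[constructor];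
     rewrite ?mxE// => ? *; rewrite ?mxE//; move=> ?; rewrite !mxE.
by rewrite (_ : (fun _ => _) = f)// diff_lin//; exact: coord_continuous.
Qed.

Lemma is_diff_sum (V : normedModType R) n (f df : 'I_n -> V -> R) x :
  (forall i, is_diff x (f i) (df i)) ->
  is_diff x (\sum_(i < n) f i) (\sum_(i < n) df i).
Proof.
move=> fdf; elim/big_ind2 : _ => //; first exact: is_diff_cst.
by move=> *; exact: is_diffD.
Qed.

Lemma is_diff_sqrt (x : R) : 0 < x ->
  is_diff x Num.sqrt (fun h => h * (2 * Num.sqrt x)^-1).
Proof.
move=> x0; have [dx dxE] := is_derive1_sqrt x0.
apply: DiffDef; first exact/derivable1_diffP.
rewrite diff1E; last exact/derivable1_diffP.
by apply/funext => h /=; rewrite derive1E dxE.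
Qed.

(** The determinant of the bordered matrix [B] is computed by eliminating either of its diagonal
    blocks; the two Schur complements are [diag_mx d + y^T *m z] and the scalar [1 + z *m w], where
    [w] is the solution of [diag_mx d *m w = y^T]. *)
Lemma det_diag_add_rank1 n (d y z : 'rV[R]_n) : (forall i, d 0 i != 0) ->
  \det (diag_mx d + y^T *m z) =
  \prod_i d 0 i * (1 + \sum_i z 0 i * y 0 i / d 0 i).
Proof.
move=> d0; pose w : 'cV[R]_n := \col_i (y 0 i / d 0 i).
have dw : diag_mx d *m w = y^T.
  apply/colP => i; rewrite mul_diag_mx !mxE mulrC divfK//.
pose B := block_mx 1%:M (- z) y^T (diag_mx d).
have detB1 : \det B = \det (diag_mx d + y^T *m z).
  rewrite (_ : B = block_mx 1%:M 0 y^T 1%:M *m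
                   block_mx 1%:M (- z) 0 (diag_mx d + y^T *m z)); last first.
    rewrite mulmx_block !mulmx0 !mul0mx !mul1mx !mulmx1 !addr0.
    by rewrite mulmxN addrCA addNr addr0.
  by rewrite det_mulmx det_lblock det_ublock !det1 !mul1r.
have detB2 : \det B = \prod_i d 0 i * (1 + \sum_i z 0 i * y 0 i / d 0 i).
  rewrite (_ : B = block_mx (1%:M + z *m w) (- z) 0 (diag_mx d) *m
                   block_mx 1%:M 0 w 1%:M); last first.
    rewrite mulmx_block !mulmx0 !mul0mx !mulmx1 !add0r.
    by rewrite mulNmx addrK dw.
  rewrite det_mulmx det_ublock det_lblock !det1 !mulr1 det_diag mulrC.
  congr (_ * _); rewrite det_mx11 !mxE eqxx; congr (_ + _).
  by apply: eq_bigr => i _; rewrite mxE mulrA.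
by rewrite -detB1.
Qed.

End matrix_calculus.

(** * Graph charts of the quadric and their area density *)

Section charts.
Context {R : realType}.

Definition sqnorm n (y : 'rV[R]_n) : R := \sum_i y 0 i ^+ 2.

(* Height of the unit sphere above [y]; outside the unit ball it is 0, so that
   its inverse is 0 there too. *)
Definition height n (y : 'rV[R]_n) : R := Num.sqrt (1 - sqnorm y).

Definition unit_ball n : set 'rV[R]_n := [set y | sqnorm y < 1].

(** Both the boundary of the ellipsoid and, for [q = 1], the unit sphere are of this form, so that
    one family of charts serves for both. *)
Definition quadric n (q : 'I_n -> R) : set 'rV[R]_n :=
  [set x | \sum_i q i ^+ 2 * x 0 i ^+ 2 = 1].

Lemma sqnorm_ge0 n (y : 'rV[R]_n) : 0 <= sqnorm y.
Proof. by apply: sumr_ge0 => i _; exact: sqr_ge0. Qed.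

Lemma height_gt0 n (y : 'rV[R]_n) : unit_ball y -> 0 < height y.
Proof. by move=> y1; rewrite sqrtr_gt0 subr_gt0. Qed.

Lemma sqr_height n (y : 'rV[R]_n) : unit_ball y -> height y ^+ 2 = 1 - sqnorm y.
Proof. by move=> y1; rewrite sqr_sqrtr// subr_ge0 ltW. Qed.

Lemma sqnorm_continuous n : continuous (@sqnorm n).
Proof.
move=> y; apply: continuous_at_sum => i.
apply: (@continuous_comp _ _ _ (fun z : 'rV[R]_n => z 0 i) (fun t => t ^+ 2)).
  exact: coord_continuous.
exact: exprn_continuous.
Qed.

Lemma height_continuous n : continuous (@height n).
Proof.
move=> y; apply: (@continuous_comp _ _ _ (fun z : 'rV[R]_n => 1 - sqnorm z) Num.sqrt).
  apply: continuousB; first exact: cst_continuous.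
  exact: sqnorm_continuous.
exact: sqrt_continuous.
Qed.

Lemma open_unit_ball n : open (@unit_ball n).
Proof.
rewrite (_ : @unit_ball n = @sqnorm n @^-1` [set x | x < 1])//.
by apply: open_comp => [y _|]; [exact: sqnorm_continuous|exact: open_lt].
Qed.

Lemma is_diff_height n (y : 'rV[R]_n) : unit_ball y ->
  is_diff y (@height n) (fun h => - ((\sum_k y 0 k * h 0 k) / height y)).
Proof.
move=> y1; have h0 := height_gt0 y1.
have dsq : is_diff y (@sqnorm n) (fun h => \sum_k 2 * y 0 k * h 0 k).
  rewrite (_ : @sqnorm n = \sum_i (fun z : 'rV[R]_n => z 0 i) ^+ 2); last first.
    by apply/funext => z; rewrite fct_sumE; apply: eq_bigr.
  apply: is_diff_eq.
    by apply: is_diff_sum => i; apply: is_diffX; exact: is_diff_coord.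
  apply/funext => h; rewrite fct_sumE; apply: eq_bigr => i _.
  by rewrite expr1.
have d1 : is_diff y (cst 1 - @sqnorm n) (0 - (fun h => \sum_k 2 * y 0 k * h 0 k)).
  by apply: is_diffB.
have y1' : 0 < (cst 1 - @sqnorm n) y by rewrite /= subr_gt0.
have := is_diff_comp d1 (is_diff_sqrt y1').
move=> dd; apply: (is_diff_eq dd).
apply/funext => h /=; rewrite sub0r mulNr; congr (- _).
rewrite invfM mulrA; congr (_ / _).
under eq_bigr do rewrite -mulrA.
by rewrite -mulr_sumr mulrC mulKf.
Qed.

Section chart_def.
Context (m : nat) (q : 'I_m.+1 -> R) (i : 'I_m.+1) (s : R).

Definition hemisphere (y : 'rV[R]_m) : 'rV[R]_m.+1 :=
  \row_j oapp (y 0) (s * height y) (unlift i j).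

Definition chart (y : 'rV[R]_m) : 'rV[R]_m.+1 :=
  rV_scale (fun j => (q j)^-1) (hemisphere y).

(** Closed form of the area density on the unit ball. Off the ball [height y = 0], so the quotient
    is 0 there and integrals over the ball extend to the whole space. *)
Definition chart_density (y : 'rV[R]_m) : R :=
  (\prod_j q j)^-1 * Num.sqrt (\sum_j q j ^+ 2 * hemisphere y 0 j ^+ 2)
    / height y.

(** Linear part of the chart and direction of its height term. The rows of [L] have no [i]-th
    coordinate and [e] has only that one, so they are orthogonal. *)
Let L : 'M[R]_(m, m.+1) := \matrix_(k, j) ((q j)^-1 *+ (j == lift i k)).
Let e : 'rV[R]_m.+1 := (s / q i) *: delta_mx 0 i.

Let chartE : chart = fun y => y *m L + height y *: e.
Proof.
apply/funext => y; apply/rowP => j; rewrite !mxE.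
case: unliftP => [k ->|->] /=.
  rewrite (bigD1 k)//= big1 ?addr0; last first.
    move=> l lk; rewrite !mxE (inj_eq lift_inj) eq_sym (negPf lk).
    by rewrite mulr0n mulr0.
  by rewrite !mxE eqxx mulr1n eq_sym (negPf (neq_lift _ _)) !mulr0 addr0 mulrC.
rewrite big1 ?add0r; last first.
  by move=> l _; rewrite !mxE (negPf (neq_lift _ _)) mulr0n mulr0.
by rewrite !eqxx mulr1; ring.
Qed.

Let is_diff_chart y : unit_ball y -> is_diff y chart
  (fun h => h *m L + (- ((\sum_k y 0 k * h 0 k) / height y)) *: e).
Proof.
move=> y1; rewrite chartE.
apply: (@is_diffD _ _ _ (fun y => y *m L) (fun y => height y *: e)).
  exact: is_diff_mulmxr.
exact: is_diff_comp (is_diff_height y1) (is_diff_scalel _ _).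
Qed.

Let jacobian_chart y : unit_ball y ->
  jacobian chart y = L - (height y)^-1 *: (y^T *m e).
Proof.
move=> y1; have [_ dE] := is_diff_chart y1.
apply/matrixP => k j; rewrite /jacobian mxE dE !mxE big_ord1 !mxE.
rewrite (bigD1 k)//= big1 ?addr0; last first.
  by move=> l lk; rewrite !mxE (negPf lk) andbF mul0r.
have -> : \sum_l y 0 l * (delta_mx 0 k : 'rV[R]_m) 0 l = y 0 k.
  rewrite (bigD1 k)//= big1 ?addr0; last first.
    by move=> l lk; rewrite !mxE (negPf lk) andbF mulr0.
  by rewrite mxE !eqxx mulr1.
rewrite !mxE !eqxx /= mul1r mulNr; congr (_ - _).
by rewrite mulrAC mulrCA mulrC !mulrA.
Qed.

Hypothesis q0 : forall j, 0 < q j.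
Hypothesis s1 : s ^+ 2 = 1.

Let sum_hemisphere y : \sum_j q j ^+ 2 * hemisphere y 0 j ^+ 2 =
  q i ^+ 2 * height y ^+ 2 + \sum_k q (lift i k) ^+ 2 * y 0 k ^+ 2.
Proof.
rewrite (bigD1_ord i)//= !mxE unlift_none /= exprMn s1 mul1r; congr (_ + _).
by apply: eq_bigr => k _; rewrite !mxE liftK.
Qed.

(** As [L *m e^T = 0], the cross terms of the Gram matrix vanish. What is left is the diagonal
    matrix [L *m L^T] plus a multiple of [y^T *m y], to which the determinant identity for a
    rank-one perturbation applies. *)
Let det_gram y : unit_ball y ->
  \det (jacobian chart y *m (jacobian chart y)^T) = chart_density y ^+ 2.
Proof.
move=> y1; have h0 := height_gt0 y1.
have q0' j : q j != 0 by rewrite gt_eqF.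
have Le : L *m e^T = 0.
  apply/matrixP => k l; rewrite !mxE (bigD1 i)//= big1 ?addr0; last first.
    by move=> j ji; rewrite !mxE (negPf ji) andbF mulr0 mulr0.
  by rewrite !mxE (negPf (neq_lift _ _)) mulr0n mul0r.
have eL : e *m L^T = 0 by rewrite -[e]trmxK -trmx_mul Le trmx0.
have LL : L *m L^T = diag_mx (\row_k (q (lift i k) ^- 2)).
  apply/matrixP => k l; rewrite !mxE (bigD1 (lift i k))//= big1 ?addr0; last first.
    by move=> j jk; rewrite !mxE (negPf jk) mulr0n mul0r.
  rewrite !mxE eqxx mulr1n (inj_eq lift_inj).
  case: eqVneq => [->|]; last by rewrite !mulr0n mulr0.
  by rewrite !mulr1n -invfM.
have ee : e *m e^T = (q i ^- 2)%:M.
  apply/matrixP => k l; rewrite !ord1 !mxE (bigD1 i)//= big1 ?addr0; last first.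
    by move=> j ji; rewrite !mxE (negPf ji) andbF !mulr0.
  rewrite !mxE !eqxx !mulr1 mulr1n -expr2 expr_div_n s1 mul1r.
  by [].
rewrite jacobian_chart//.
(* Only the products of [L] and [e] matter from here on. *)
move: (L) (e) Le eL LL ee => M u Le eL LL ee.
have -> : (M - (height y)^-1 *: (y^T *m u))^T = M^T - (height y)^-1 *: (u^T *m y).
  by rewrite raddfB/= linearZ/= trmx_mul trmxK.
rewrite mulmxBl !mulmxBr.
rewrite -!scalemxAl -!scalemxAr LL mulmxA Le mul0mx scaler0 subr0.
rewrite -mulmxA eL mulmx0 scaler0 sub0r opprK.
rewrite mulmxA -(mulmxA y^T) ee mul_mx_scalar -scalemxAl !scalerA.
rewrite scalemxAr det_diag_add_rank1; last first.
  by move=> k; rewrite mxE invr_neq0// expf_neq0.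
rewrite /chart_density !exprMn sqr_sqrtr; last first.
  by apply: sumr_ge0 => j _; rewrite mulr_ge0// sqr_ge0.
rewrite sum_hemisphere (bigD1_ord i)//=.
under eq_bigr do rewrite mxE.
under [X in _ * (1 + X)]eq_bigr do rewrite !mxE invrK -mulrA mulrC.
rewrite prodfV prodrXl.
set P := \prod_k _; set S := \sum_k q _ ^+ 2 * _.
have P0 : P != 0 by apply/prodf_neq0 => k _.
rewrite (_ : \sum_k _ = (height y)^-1 * (height y)^-1 * q i ^- 2 * S); last first.
  by rewrite mulr_sumr; apply: eq_bigr => k _; ring.
(* With [h = height y], both sides equal [P ^- 2 * (1 + S / (h ^+ 2 * q i ^+ 2))]. *)
have := q0' i; have : height y != 0 by rewrite gt_eqF.
by move=> ? ?; field; rewrite P0; do ?[apply/andP; split].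
Qed.

Lemma chart_density_ge0 y : 0 <= chart_density y.
Proof.
rewrite !mulr_ge0// ?invr_ge0 ?sqrtr_ge0//.
by apply: prodr_ge0 => j _; exact: ltW.
Qed.

(** The [i]-th term [q i ^+ 2 * height y ^+ 2] alone makes the sum under the root positive. This is
    what gives the chart full rank. *)
Lemma chart_density_gt0 y : unit_ball y -> 0 < chart_density y.
Proof.
move=> y1; have h0 := height_gt0 y1.
rewrite !mulr_gt0// ?invr_gt0//; first exact: prodr_gt0.
rewrite sqrtr_gt0 sum_hemisphere ltr_wpDr//.
  by apply: sumr_ge0 => k _; rewrite mulr_ge0// sqr_ge0.
by rewrite mulr_gt0// exprn_gt0.
Qed.

Lemma area_density_chart y : unit_ball y -> area_density chart y = chart_density y.
Proof.
by move=> y1; rewrite /area_density det_gram// sqrtr_sqr ger0_norm// chart_density_ge0.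
Qed.

Lemma quadric_chart y : unit_ball y -> quadric q (chart y).
Proof.
move=> y1; rewrite /quadric/=.
have -> : \sum_j q j ^+ 2 * chart y 0 j ^+ 2 = \sum_j 1 ^+ 2 * hemisphere y 0 j ^+ 2.
  apply: eq_bigr => j _; rewrite mxE exprMn mulrA -exprMn divff ?gt_eqF//.
rewrite (bigD1_ord i)//= !mxE unlift_none /= exprMn s1 !expr1n !mul1r.
rewrite sqr_height// /sqnorm.
under eq_bigr do rewrite !mxE liftK mul1r.
by rewrite subrK.
Qed.

(** The inverse of the chart forgets the [i]-th coordinate and rescales the others. On the quadric
    [1 - sqnorm y] is the square of [q i * x 0 i], and the sign [s] selects the root. *)
Lemma image_chart : chart @` (@unit_ball m) =
  quadric q `&` [set x | 0 < s * x 0 i].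
Proof.
have q0' j : q j != 0 by rewrite gt_eqF.
apply/seteqP; split=> [_ [y y1 <-]|x [xq sx]].
  split; first exact: quadric_chart.
  rewrite /= !mxE unlift_none /= mulrCA mulr_gt0 ?invr_gt0//.
  by rewrite mulrA -expr2 s1 mul1r height_gt0.
pose y : 'rV[R]_m := \row_k (q (lift i k) * x 0 (lift i k)).
have yE : 1 - sqnorm y = (s * (q i * x 0 i)) ^+ 2.
  rewrite exprMn s1 mul1r exprMn -xq (bigD1_ord i)//= /sqnorm.
  under [X in _ - X]eq_bigr do rewrite mxE exprMn.
  by rewrite addrK.
have sqx : 0 < s * (q i * x 0 i) by rewrite mulrCA mulr_gt0.
have y1 : unit_ball y by rewrite /unit_ball/= -subr_gt0 yE exprn_gt0.
exists y => //; apply/rowP => j; rewrite !mxE; case: unliftP => [k ->|->] /=.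
  by rewrite mxE mulKf.
rewrite /height yE sqrtr_sqr gtr0_norm// (mulrA s) -expr2 s1 mul1r.
by rewrite mulKf.
Qed.

Lemma chart_inj : injective chart.
Proof.
move=> y z /rowP yz; apply/rowP => k; have := yz (lift i k).
by rewrite !mxE !liftK/=; apply: mulfI; rewrite invr_eq0 gt_eqF.
Qed.

Lemma regular_chart : regular_param (quadric q) (@unit_ball m) chart.
Proof.
split.
- exact: open_unit_ball.
- by move=> y /is_diff_chart[].
- move=> y y1.
  rewrite /prop_for /continuous_at jacobian_chart//.
  have : {for y, continuous (fun y : 'rV[R]_m => L - (height y)^-1 *: (y^T *m e))}.
    apply: continuous_at_mx => k j.
    rewrite (_ : (fun _ => _) = fun z : 'rV[R]_m =>
        L k j - (height z)^-1 * (z 0 k * e 0 j)); last first.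
      by apply/funext => z; rewrite !mxE big_ord1 !mxE.
    apply: continuousB; first exact: cst_continuous.
    apply: continuousM.
      apply: continuousV; first by rewrite gt_eqF// height_gt0.
      exact: height_continuous.
    apply: continuousM; last exact: cst_continuous.
    exact: coord_continuous.
  (* The closed form is the Jacobian on the ball only, which suffices because the ball is a
     neighbourhood of [y]. *)
  move=> cJ; apply: cvg_trans cJ.
  apply: (@near_eq_cvg _ _ (nbhs y)); near=> z.
  rewrite jacobian_chart//; near: z.
  exact: open_nbhs_nbhs (conj (@open_unit_ball m) y1).
- move=> y y1; apply/row_freeP.
  set J := jacobian _ _.
  (* The Gram matrix is invertible, its determinant being the square of a positive density, so [J]
     has a right inverse. *)
  exists (J^T *m invmx (J *m J^T)); rewrite mulmxA mulmxV//.
  by rewrite unitmxE det_gram// unitfE expf_neq0// gt_eqF// chart_density_gt0.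
- split; first by move=> ? ? _ _; exact: chart_inj.
  by rewrite image_chart; exact: subIsetl.
Unshelve. all: by end_near. Qed.

End chart_def.
End charts.

(** * Measurability of the charts, their densities and the sets involved *)

Section measurability.
Context {R : realType}.

(** Inversion is continuous on the open set of nonzero reals; the point 0 is treated apart. *)
Lemma measurable_invr : measurable_fun [set: R] (@GRing.inv R).
Proof.
rewrite -(setvU [set (0 : R)]); apply/measurable_funU => //.
  exact: measurableC.
split; last exact: measurable_fun_set1.
apply: open_continuous_measurable_fun.
  exact/closed_openC/closed_eq.
by move=> x; rewrite inE/= => /eqP x0; exact: inv_continuous.
Qed.

Lemma measurable_sqrtr : measurable_fun [set: R] (@Num.sqrt R).
Proof. by apply: continuous_measurable_fun; exact: sqrt_continuous. Qed.

Lemma measurable_coord n (j : 'I_n) :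
  measurable_fun [set: 'rV[R]_n] (fun x => x 0 j : R).
Proof. exact: measurable_rV_coord. Qed.

Lemma measurable_quadratic_form n (q : 'I_n -> R) :
  measurable_fun [set: 'rV[R]_n] (fun x => \sum_i q i ^+ 2 * x 0 i ^+ 2 : R).
Proof.
apply: measurable_sum => i; apply: measurable_funM => //.
by apply: measurable_funX; exact: measurable_coord.
Qed.

Lemma measurable_sqnorm n : measurable_fun [set: 'rV[R]_n] (@sqnorm R n).
Proof.
by apply: measurable_sum => i; apply: measurable_funX; exact: measurable_coord.
Qed.

Lemma measurable_height n : measurable_fun [set: 'rV[R]_n] (@height R n).
Proof.
apply: (measurableT_comp measurable_sqrtr).
by apply: measurable_funB => //; exact: measurable_sqnorm.
Qed.

Lemma measurable_unit_ball n : measurable (@unit_ball R n).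
Proof.
rewrite (_ : @unit_ball R n = @sqnorm R n @^-1` [set` `]-oo, 1[%R]).
  by rewrite -[X in measurable X]setTI; exact: measurable_sqnorm.
by apply/seteqP; split => y /=; rewrite in_itv.
Qed.

Lemma measurable_quadric n (q : 'I_n -> R) : measurable (quadric q).
Proof.
rewrite (_ : quadric q =
  (fun x => \sum_i q i ^+ 2 * x 0 i ^+ 2) @^-1` [set 1])//.
by rewrite -[X in measurable X]setTI; exact: measurable_quadratic_form.
Qed.

Lemma measurable_hyperplane n (j : 'I_n) :
  measurable [set x : 'rV[R]_n | x 0 j = 0].
Proof.
rewrite (_ : [set _ | _] = (fun x : 'rV[R]_n => x 0 j) @^-1` [set 0])//.
by rewrite -[X in measurable X]setTI; exact: measurable_coord.
Qed.

Lemma measurable_halfspace n (s : R) (j : 'I_n) :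
  measurable [set x : 'rV[R]_n | 0 < s * x 0 j].
Proof.
rewrite (_ : [set _ | _] = (fun x : 'rV[R]_n => s * x 0 j) @^-1` [set` `]0, +oo[%R]).
  rewrite -[X in measurable X]setTI.
  suff: measurable_fun [set: 'rV[R]_n] (fun x => s * x 0 j : R) by exact.
  by apply: measurable_funM => //; exact: measurable_coord.
by apply/seteqP; split => y /=; rewrite in_itv/= andbT.
Qed.

Lemma measurable_hemisphere m (i : 'I_m.+1) (s : R) :
  measurable_fun [set: 'rV[R]_m] (hemisphere i s).
Proof.
apply: measurable_fun_rV => j; case: (unliftP i j) => [k ->|->].
- rewrite (_ : _ \o _ = rV_coord k); first exact: measurable_rV_coord.
  by apply/funext => y /=; rewrite /rV_coord mxE liftK.
- rewrite (_ : _ \o _ = fun y => s * height y).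
    by apply: measurable_funM => //; exact: measurable_height.
  by apply/funext => y /=; rewrite /rV_coord mxE unlift_none.
Qed.

Lemma measurable_chart m (q : 'I_m.+1 -> R) i s :
  measurable_fun [set: 'rV[R]_m] (chart q i s).
Proof.
apply: (measurableT_comp (measurable_rV_scale _)).
exact: measurable_hemisphere.
Qed.

Lemma measurable_chart_density m (q : 'I_m.+1 -> R) i s :
  measurable_fun [set: 'rV[R]_m] (chart_density q i s).
Proof.
apply: measurable_funM; last first.
  by apply: (measurableT_comp measurable_invr); exact: measurable_height.
apply: measurable_funM => //; apply: (measurableT_comp measurable_sqrtr).
apply: (measurableT_comp (measurable_quadratic_form q)).
exact: measurable_hemisphere.
Qed.

End measurability.

(** * Integration over the quadric against its surface measure *)

Section surface_integral.
Context {R : realType} (m : nat) (q : 'I_m.+1 -> R).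
Variable mu : {measure set 'rV[R]_m.+1 -> \bar R}.
Hypothesis q0 : forall j, 0 < q j.
Hypothesis hmu : is_surface_measure m (quadric q) mu.

Let muE i (s : R) A : s ^+ 2 = 1 -> measurable A -> A `<=` @unit_ball R m ->
  mu (chart q i s @` A) = (\int[lebesgue_rV m]_(y in A) (chart_density q i s y)%:E)%E.
Proof.
move=> s1 mA AU; have [_ /(_ _ _ (regular_chart i q0 s1) A mA AU) ->] := hmu.
by apply: eq_integral => y /[!inE] Ay; rewrite area_density_chart//; exact: AU.
Qed.

(** If [i] is the first index, the two conditions on [x] exclude each other. Otherwise the first
    coordinate is a parameter of the chart, up to scaling, and the set is the image of a part of a
    hyperplane, which is Lebesgue null. *)
Let mu_hyperplane_halfspace i (s : R) : s ^+ 2 = 1 ->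
  mu (quadric q `&` [set x | x 0 ord0 = 0] `&` [set x | 0 < s * x 0 i]) = 0%E.
Proof.
move=> s1; case: (unliftP i ord0) => [k ik|i0]; last first.
  rewrite (_ : _ `&` _ = set0) ?measure0//.
  by apply/seteqP; split => // x [[_ /= x0]]; rewrite -i0 x0 mulr0 ltxx.
pose A := @unit_ball R m `&` [set y | y 0 k = 0].
have mA : measurable A.
  by apply: measurableI; [exact: measurable_unit_ball|exact: measurable_hyperplane].
have AU : A `<=` @unit_ball R m by exact: subIsetl.
have -> : quadric q `&` [set x | x 0 ord0 = 0] `&` [set x | 0 < s * x 0 i] =
    chart q i s @` A.
  rewrite setIAC -image_chart//; apply/seteqP; split => [_ [[y y1 <-]]|_ [y [y1 y0] <-]].
    rewrite /= ik !mxE liftK/= => /eqP; rewrite mulf_eq0 invr_eq0 gt_eqF//= => /eqP y0.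
    by exists y.
  split; first by exists y.
  by rewrite /= ik !mxE liftK/= y0 mulr0.
rewrite muE//; apply: null_set_integral => //.
  by apply: measurable_funTS; apply/measurable_EFinP; exact: measurable_chart_density.
apply/eqP; rewrite eq_le measure_ge0 andbT -(lebesgue_rV_hyperplane k).
apply: le_measure; rewrite ?inE//; first exact: measurable_hyperplane.
exact: subIsetr.
Qed.

(** A point of the quadric has a nonzero coordinate, so the half-spaces [0 < s * x 0 i] with
    [s = 1, -1] cover it, and the set is null in each of them. *)
Lemma surface_measure_hyperplane :
  mu (quadric q `&` [set x | x 0 ord0 = 0]) = 0%E.
Proof.
set N := _ `&` _.
have mN : measurable N.
  by apply: measurableI; [exact: measurable_quadric|exact: measurable_hyperplane].
have mNh s i : measurable (N `&` [set x | 0 < s * x 0 i]).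
  by apply: measurableI => //; exact: measurable_halfspace.
apply/(negligibleP mu mN).
(* The union is indexed by natural numbers; for [k > m] the default value of [inord] only repeats an
   earlier set. *)
pose F (k : nat) := (N `&` [set x | 0 < 1 * x 0 (inord k)]) `|`
                    (N `&` [set x | 0 < -1 * x 0 (inord k)]).
have Fnull k : mu.-negligible (F k).
  apply: negligibleU; apply/negligibleP => //.
    by apply: mu_hyperplane_halfspace; rewrite expr1n.
  by apply: mu_hyperplane_halfspace; rewrite sqrrN expr1n.
apply: negligibleS (negligible_bigcup Fnull) => x Nx.
have [i xi0] : exists i, x 0 i != 0.
  apply/existsP; rewrite -negb_forall; apply/negP => /forallP x0.
  have [+ _] := Nx; rewrite /quadric/= big1 => [|i _]; last first.
    by have /eqP -> := x0 i; rewrite expr0n mulr0.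
  by move=> /esym/eqP; rewrite oner_eq0.
exists (val i) => //; rewrite /F inord_val.
have [xi|xi|xi] := ltgtP (x 0 i) 0; last by rewrite xi eqxx in xi0.
  by right; split => //=; rewrite mulN1r oppr_gt0.
by left; split => //=; rewrite mul1r.
Qed.

Lemma surface_integral_half (s : R) (f : 'rV[R]_m.+1 -> \bar R) : s ^+ 2 = 1 ->
  measurable_fun [set: 'rV[R]_m.+1] f -> (forall x, 0 <= f x)%E ->
  (\int[mu]_(x in quadric q `&` [set x | (0 < s * x 0 ord0)%R]) f x =
   \int[lebesgue_rV m]_y (f (chart q ord0 s y) *
     (chart_density q ord0 s y)%:E))%E.
Proof.
move=> s1 mf f0.
rewrite (@ge0_integral_transfer_density _ _ _ _ _ (lebesgue_rV m) mu
  (chart q ord0 s) (chart_density q ord0 s) (@unit_ball R m))//.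
(* The domain grows from the ball to the whole space, the density being 0 off the ball. *)
- rewrite integral_mkcond; apply: eq_integral => y _; rewrite /patch.
  case: ifPn => // yU; rewrite /chart_density.
  rewrite (_ : height y = 0) ?invr0 ?mulr0 ?mule0//.
  apply/eqP; rewrite sqrtr_eq0 subr_le0 leNgt.
  by apply: contra yU => y1; rewrite inE.
- exact: measurable_chart.
- exact: measurable_chart_density.
- by move=> y; exact: chart_density_ge0.
- exact: measurable_unit_ball.
- by apply: measurableI; [exact: measurable_quadric|exact: measurable_halfspace].
- move=> B mB; rewrite -muE//; last first.
    apply: measurableI; first exact: measurable_unit_ball.
    by rewrite -[X in measurable X]setTI; exact: measurable_chart.
  congr (mu _); rewrite -image_chart//; apply/seteqP; split.
    by move=> _ [[y y1 <-] By]; exists y.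
  by move=> _ [y [y1 By] <-]; split => //; exists y.
Qed.

Lemma surface_integral (f : 'rV[R]_m.+1 -> \bar R) :
  measurable_fun [set: 'rV[R]_m.+1] f -> (forall x, 0 <= f x)%E ->
  (\int[mu]_(x in quadric q) f x =
   \int[lebesgue_rV m]_y (f (chart q ord0 1 y) *
     (chart_density q ord0 1 y)%:E) +
   \int[lebesgue_rV m]_y (f (chart q ord0 (-1) y) *
     (chart_density q ord0 (-1) y)%:E))%E.
Proof.
move=> mf f0.
have mq : measurable (quadric q) by exact: measurable_quadric.
have mH s : measurable (quadric q `&` [set x | 0 < s * x 0 ord0]).
  by apply: measurableI => //; exact: measurable_halfspace.
have mN : measurable (quadric q `&` [set x | x 0 ord0 = 0]).
  by apply: measurableI => //; exact: measurable_hyperplane.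
rewrite -!surface_integral_half// ?sqrrN ?expr1n//.
rewrite -ge0_integral_setU//; last 2 first.
- exact: measurable_funTS.
- apply/disj_setPS => x [[_ /= +] [_ /= +]]; lra.
pose H (s : R) := quadric q `&` [set x | 0 < s * x 0 ord0].
pose N := quadric q `&` [set x | x 0 ord0 = 0].
(* The quadric is split by the sign of the first coordinate; the part [N] where it vanishes is
   null. *)
transitivity (\int[mu]_(x in (H 1%R `|` H (-1)%R) `|` N) f x)%E.
  congr (integral _ _ _); apply/seteqP; split => x /=; last by move=> [[[]|[]]|[]].
  move=> xq; have [x0|x0|x0] := ltgtP (x 0 ord0) 0;
    [left; right|left; left|right]; split => //=.
    by rewrite mulN1r oppr_gt0.
  by rewrite mul1r.
rewrite [LHS]ge0_integral_setU//; last 3 first.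
- by apply: measurableU; exact: mH.
- exact: measurable_funTS.
- apply/disj_setPS => x [xH [_ /= x0]].
  by case: xH => -[_ /=]; rewrite x0 mulr0 ltxx.
rewrite [X in (_ + X)%E](_ : _ = 0%E) ?adde0//.
apply: null_set_integral => //; first exact: measurable_funTS.
exact: surface_measure_hyperplane.
Qed.

End surface_integral.

(** * The integral of [1 / height] against that of [height] *)

Section cone_identity.
Context {R : realType}.
Notation leb := (@lebesgue_measure R).

(** This integral is the source of the factor [n] relating the area of the sphere to the volume of
    the ball. *)
Lemma integral_expr_01 m :
  (\int[leb]_(s in `]0%R, 1%R]) (s ^+ m)%:E = (m.+1%:R^-1)%:E)%E.
Proof.
rewrite integral_itv_obnd_cbnd; last first.
  apply/measurable_EFinP/measurable_funTS.
  by apply: measurable_funX; exact: measurable_id.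
pose F := fun s : R => m.+1%:R^-1 * s ^+ m.+1.
have dF (s : R) : is_derive s 1 F (s ^+ m).
  rewrite (_ : F = m.+1%:R^-1 \*: (id ^+ m.+1)); last first.
    by apply/funext => t; rewrite /F fctE.
  apply: is_derive_eq; rewrite /= /GRing.scale/= mulr1.
  by rewrite mulKf// pnatr_eq0.
have cF : continuous F.
  by move=> s; apply/differentiable_continuous/derivable1_diffP.
rewrite (@continuous_FTC2 _ (fun s => s ^+ m) F)//.
- by rewrite /F expr1n mulr1 expr0n/= mulr0 sube0.
- by apply: continuous_subspaceT => s; exact: exprn_continuous.
- split=> //.
  + by apply: cvg_at_right_filter; exact: cF.
  + by apply: cvg_at_left_filter; exact: cF.
- by move=> s _; rewrite derive1E derive_val.
Qed.

(** Derivative in [s] of [Num.sqrt (s ^+ 2 - a)] where [a < s ^+ 2]; it is 0 where [s ^+ 2 <= a], as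
    the root and then its inverse are 0. *)
Let kern (a s : R) := s / Num.sqrt (s ^+ 2 - a).

Let continuous_sqrt_sqrB (a : R) :
  continuous (fun s : R => Num.sqrt (s ^+ 2 - a)).
Proof.
move=> s; apply: (@continuous_comp _ _ _ (fun s : R => s ^+ 2 - a) Num.sqrt).
  apply: continuousB; last exact: cst_continuous.
  exact: exprn_continuous.
exact: sqrt_continuous.
Qed.

Let kern_ge0 a s : 0 <= s -> 0 <= kern a s.
Proof. by move=> s0; rewrite divr_ge0// sqrtr_ge0. Qed.

Let measurable_kern a : measurable_fun [set: R] (kern a).
Proof.
apply: measurable_funM => //; apply: (measurableT_comp measurable_invr).
apply: (measurableT_comp measurable_sqrtr).
by apply: measurable_funB => //; apply: measurable_funX.
Qed.

(** The bound [Num.sqrt a < c] keeps the interval away from the singularity, so the fundamental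
    theorem of calculus applies. *)
Let integral_kern_itv (a c : R) : 0 <= a -> Num.sqrt a < c -> c < 1 ->
  (\int[leb]_(s in `[c, 1%R]) (kern a s)%:E =
   (Num.sqrt (1 - a) - Num.sqrt (c ^+ 2 - a))%:E)%E.
Proof.
move=> a0 ac c1; pose F s := Num.sqrt (s ^+ 2 - a).
have pos s : c <= s -> 0 < s ^+ 2 - a.
  move=> cs; have sa := lt_le_trans ac cs.
  have s0 : 0 <= s by rewrite (le_trans (sqrtr_ge0 a))// ltW.
  by rewrite subr_gt0 -(sqr_sqrtr a0) ltr_pXn2r ?nnegrE ?sqrtr_ge0.
have dF (s : R) : c <= s -> is_derive s 1 F (kern a s).
  move=> cs; have s0 := pos _ cs.
  have d1 : is_derive s 1 (id ^+ 2 - cst a : R -> R) (2 * s).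
    by apply: is_derive_eq; rewrite subr0 expr1 /GRing.scale/= mulr1.
  have s0' : 0 < (id ^+ 2 - cst a : R -> R) s by [].
  have d2 := is_derive1_sqrt s0'.
  have := is_derive1_comp d2 d1.
  rewrite (_ : Num.sqrt \o _ = F)// => dFs; apply: (is_derive_eq dFs).
  change ((2 * Num.sqrt (s ^+ 2 - a))^-1 * (2 * s) = s / Num.sqrt (s ^+ 2 - a)).
  by field; rewrite gt_eqF// sqrtr_gt0.
have cF : continuous F by exact: continuous_sqrt_sqrB.
rewrite (@continuous_FTC2 _ (kern a) F)//.
- by rewrite /F expr1n EFinB.
- apply: continuous_in_subspaceT => s; rewrite inE/= in_itv/= => /andP[cs _].
  apply: (@continuousM _ _ id (fun t => (F t)^-1)) => //.
  apply: continuousV; last exact: cF.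
  by rewrite gt_eqF// sqrtr_gt0 pos.
- split.
  + move=> s; rewrite in_itv/= => /andP[/ltW cs _].
    by have [] := dF s cs.
  + by apply: cvg_at_right_filter; exact: cF.
  + by apply: cvg_at_left_filter; exact: cF.
- move=> s; rewrite in_itv/= => /andP[/ltW cs _].
  by have := dF s cs => ?; rewrite derive1E derive_val.
Qed.

(** An improper integral: the kernel vanishes up to [b = Num.sqrt a], and the rest is exhausted by
    the intervals [[c n, 1]] with [c n] decreasing to [b]. For [1 <= a] both sides are 0. *)
Let integral_kern (a : R) : 0 <= a ->
  (\int[leb]_(s in `]0%R, 1%R]) (kern a s)%:E = (Num.sqrt (1 - a))%:E)%E.
Proof.
move=> a0; set b := Num.sqrt a.
have b0 : 0 <= b by exact: sqrtr_ge0.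
have kern0 s : 0 <= s -> s <= b -> kern a s = 0.
  move=> s0 sb; rewrite /kern (_ : Num.sqrt _ = 0) ?invr0 ?mulr0//.
  apply/eqP; rewrite sqrtr_eq0 subr_le0 -(sqr_sqrtr a0).
  by rewrite lerXn2r ?nnegrE.
have [a1|a1] := leP 1 a.
  rewrite integral0_eq.
    by congr EFin; apply/esym/eqP; rewrite sqrtr_eq0 subr_le0.
  move=> s /=; rewrite in_itv/= => /andP[s0 s1].
  by rewrite kern0 ?(ltW s0)// (le_trans s1)// -sqrtr1 ler_sqrt.
have b1 : b < 1 by rewrite -sqrtr1 ltr_sqrt.
(* The denominator [n.+2] rather than [n.+1] makes [c n < 1] already for [n = 0]. *)
pose c n : R := b + (1 - b) / n.+2%:R.
have bc n : b < c n by rewrite ltrDl divr_gt0// subr_gt0.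
have c1 n : c n < 1.
  rewrite /c -ltrBrDl ltr_pdivrMr// ltr_pMr ?subr_gt0// ltr1n//.
have cb : c n @[n --> \oo] --> b.
  rewrite -[X in _ --> X]addr0; apply: cvgD; first exact: cvg_cst.
  rewrite -[X in _ --> X](mulr0 (1 - b)); apply: cvgM; first exact: cvg_cst.
  by rewrite (cvg_shiftS (@harmonic R)); exact: cvg_harmonic.
have -> : (\int[leb]_(s in `]0%R, 1%R]) (kern a s)%:E =
    \int[leb]_(s in \bigcup_n [set` `[c n, 1%R]]) (kern a s)%:E)%E.
  rewrite integral_mkcond [RHS]integral_mkcond; apply: eq_integral => s _.
  rewrite /patch; case: ifPn => [|sN]; rewrite ?inE/= ?in_itv/=.
    move=> /andP[s0 s1]; case: ifPn => // sN.
    rewrite kern0 ?(ltW s0)// leNgt; apply: contra sN => bs; rewrite inE.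
    have [n /ltW cs] := filter_ex (cvgr_lt b cb s bs).
    by exists n => //=; rewrite in_itv/= cs s1.
  case: ifPn => //; rewrite inE => -[n _ /=]; rewrite in_itv/= => /andP[cs s1].
  move/negP : sN; rewrite inE/= in_itv/= s1 andbT => -[].
  exact: le_lt_trans b0 (lt_le_trans (bc n) cs).
have mono : nondecreasing_seq (fun n => [set` `[c n, 1%R]] : set R).
  apply/nondecreasing_seqP => n; rewrite subsetEset; apply: subset_itvr.
  rewrite bnd_simp lerD2l ler_pM2l ?subr_gt0// lef_pV2 ?posrE ?ltr0n//.
  by rewrite ler_nat.
have cvg1 : (\int[leb]_(x in `[c i, 1%R]) (kern a x)%:E @[i --> \oo] -->
    \int[leb]_(x in \bigcup_i [set` `[c i, 1%R]]) (kern a x)%:E)%E.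
  apply: ge0_nondecreasing_set_cvg_integral => //.
    move=> i; apply: measurable_funTS; apply/measurable_EFinP.
    exact: measurable_kern.
  move=> i s /=; rewrite in_itv/= => /andP[cs _]; rewrite lee_fin kern_ge0//.
  by rewrite (le_trans b0)// (le_trans _ cs)// ltW.
rewrite -(cvg_lim (@ereal_hausdorff R) cvg1).
apply: cvg_lim => //.
under eq_fun do rewrite integral_kern_itv//.
apply: cvg_EFin; first by near=> n.
(* The boundary term at [c n] tends to [Num.sqrt (b ^+ 2 - a) = 0]. *)
rewrite -[X in _ --> X]subr0.
apply: cvgB; first exact: cvg_cst.
have -> : 0 = Num.sqrt (b ^+ 2 - a) by rewrite /b sqr_sqrtr// subrr sqrtr0.
apply: (@cvg_comp _ _ _ c (fun s => Num.sqrt (s ^+ 2 - a)) _ (nbhs b)) => //.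
exact: continuous_sqrt_sqrB.
Unshelve. all: by end_near. Qed.


(* Tonelli for [s / sqrt (s^2 - |y|^2)] on [0 < s <= 1]: integrating in [s]
   first gives [height y]; in [y] first, the substitution [y = s z] gives
   [s^m] times the left-hand side. *)
Lemma integral_inv_height m :
  (\int[lebesgue_rV m]_y ((@height R m y)^-1)%:E =
   m.+1%:R%:E * \int[lebesgue_rV m]_y (@height R m y)%:E)%E.
Proof.
set G := (\int[_]_y ((height y)^-1)%:E)%E.
have G0 : (0 <= G)%E.
  by apply: integral_ge0 => y _; rewrite lee_fin invr_ge0 sqrtr_ge0.
pose f (p : measurableTypeR R * 'rV[R]_m) : \bar R :=
  (\1_(`]0, 1]%classic) p.1 * kern (sqnorm p.2) p.1)%:E.
have f0 p : (0 <= f p)%E.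
  rewrite /f lee_fin indicE.
  case: (boolP (p.1 \in _)) => [|_]; last by rewrite mul0r.
  by rewrite inE/= in_itv/= => /andP[p0 _]; rewrite mul1r kern_ge0// ltW.
have mf : measurable_fun setT f.
  apply/measurable_EFinP; apply: measurable_funM.
    by apply: measurableT_comp => //; exact: measurable_indic.
  apply: measurable_funM => //; apply: (measurableT_comp measurable_invr).
  apply: (measurableT_comp measurable_sqrtr); apply: measurable_funB.
    exact: measurable_funX.
  by apply: measurableT_comp => //; exact: measurable_sqnorm.
have fy y : (\int[leb]_s f (s, y) = (height y)%:E)%E.
  rewrite -integral_kern ?sqnorm_ge0// [RHS]integral_mkcond.
  apply: eq_integral => s _; rewrite /patch /f /= indicE.
  by case: ifPn => _; rewrite ?mul1r ?mul0r.
pose g (s : R) := ((fun s => (s ^+ m)%:E) \_ `]0%R, 1%R]%classic) s : \bar R.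
have fs s : (\int[lebesgue_rV m]_y f (s, y) = G * g s)%E.
  rewrite /g /patch /f /= indicE; case: ifPn => [|_]; last first.
    by rewrite mule0; apply: integral0_eq => y _; rewrite mul0r.
  rewrite inE/= in_itv/= => /andP[s0 _].
  have := @ge0_integral_lebesgue_rV_scale R m (fun=> s)
    (fun y => (kern (sqnorm y) s)%:E) (fun=> s0).
  rewrite prodr_const card_ord => scale.
  rewrite [G](_ : _ = (s ^+ m)^-1%:E *
      \int[lebesgue_rV m]_y (kern (sqnorm y) s)%:E)%E; last first.
    rewrite -scale; last 2 first.
    - apply/measurable_EFinP; apply: measurable_funM => //.
      apply: (measurableT_comp measurable_invr).
      apply: (measurableT_comp measurable_sqrtr); apply: measurable_funB => //.
      exact: measurable_sqnorm.
    - by move=> y; rewrite lee_fin kern_ge0// ltW.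
    apply: eq_integral => y _; congr EFin.
    (* After the substitution the kernel reads [s / (s * height y)]. Off the ball this is still
       [(height y)^-1], both being 0. *)
    have -> : sqnorm (rV_scale (fun=> s) y) = s ^+ 2 * sqnorm y.
      by rewrite /sqnorm mulr_sumr; apply: eq_bigr => i _; rewrite mxE exprMn.
    rewrite /kern -[X in X - _]mulr1 -mulrBr sqrtrM ?sqr_ge0// sqrtr_sqr.
    by rewrite gtr0_norm// invfM mulrA divff ?mul1r// gt_eqF.
  rewrite muleAC -EFinM mulVf ?mul1e; last by rewrite expf_neq0// gt_eqF.
  by apply: eq_integral => y _; rewrite mul1r.
have -> : (\int[lebesgue_rV m]_y (height y)%:E = \int[leb]_s (G * g s))%E.
  transitivity (\int[lebesgue_rV m]_y \int[leb]_s f (s, y))%E.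
    by apply: eq_integral => y _; rewrite fy.
  rewrite -[LHS](@fubini_tonelli _ _ _ _ R leb (lebesgue_rV m) f mf f0).
  by apply: eq_integral => s _; rewrite -fs.
rewrite ge0_integralZl//; last 2 first.
- apply/(measurable_restrictT _ _).1 => //.
  by apply/measurable_EFinP/measurable_funTS; exact: measurable_funX.
- move=> s _; rewrite /g /patch; case: ifPn => //.
  by rewrite inE/= in_itv/= => /andP[s0 _]; rewrite lee_fin exprn_ge0// ltW.
rewrite -integral_mkcond integral_expr_01.
by rewrite muleC -muleA -EFinM mulVf ?pnatr_eq0// mule1.
Qed.

End cone_identity.

(** * Volumes of the ellipsoid and of the unit ball *)

Section volume.
Context {R : realType}.
Local Open Scope ereal_scope.

Lemma measurable_ellipsoid n (q : 'I_n -> R) : measurable (ellipsoid q).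
Proof.
rewrite (_ : ellipsoid q =
  (fun x => \sum_i q i ^+ 2 * x 0%R i ^+ 2)%R @^-1` [set` `]-oo, 1%R]%R]).
  by rewrite -[X in measurable X]setTI; exact: measurable_quadratic_form.
by apply/seteqP; split => x /=; rewrite in_itv.
Qed.

Lemma ellipsoid_scale n (q : 'I_n -> R) :
  ellipsoid q = rV_scale q @^-1` ellipsoid (fun=> 1%R).
Proof.
have E x : (\sum_i 1 ^+ 2 * rV_scale q x 0 i ^+ 2 =
    \sum_i q i ^+ 2 * x 0 i ^+ 2)%R.
  by apply: eq_bigr => i _; rewrite mxE expr1n mul1r exprMn.
by apply/seteqP; split => x; rewrite /ellipsoid /= E.
Qed.

Lemma lebesgue_rV_ellipsoid n (q : 'I_n -> R) : (forall i, 0 < q i)%R ->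
  lebesgue_rV n (ellipsoid q) =
  ((\prod_i q i)^-1)%:E * lebesgue_rV n (ellipsoid (fun=> 1%R)).
Proof.
move=> q0; rewrite ellipsoid_scale lebesgue_rV_preimage_scale//.
exact: measurable_ellipsoid.
Qed.

(** Slicing along the first coordinate: the slice above [y] is the segment from [- height y] to
    [height y], or is empty when [1 < sqnorm y], where [height y = 0] as well. *)
Lemma lebesgue_rV_ball m :
  lebesgue_rV m.+1 (ellipsoid (fun=> 1%R)) =
  2%:E * \int[lebesgue_rV m]_y (@height R m y)%:E.
Proof.
set E := ellipsoid _.
have mE : measurable E by exact: measurable_ellipsoid.
pose B := @rV_cons R m @^-1` E.
have mB : measurable B.
  by rewrite /B -[X in measurable X]setTI; exact: measurable_rV_cons.
have BE t y : B (t, y) <-> (t ^+ 2 <= 1 - sqnorm y)%R.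
  rewrite /B /E /ellipsoid /=.
  under eq_bigr do rewrite expr1n mul1r.
  rewrite big_ord_recl !mxE unlift_none/=.
  under eq_bigr do rewrite mxE liftK/=.
  by rewrite lerBrDr.
transitivity (\int[lebesgue_measure \x lebesgue_rV m]_z (\1_B z)%:E).
  by rewrite integral_indic// setIT.
rewrite fubini_tonelli2//=; last first.
  by apply/measurable_EFinP; exact: measurable_indic.
rewrite -ge0_integralZl//=; last 2 first.
- by apply/measurable_EFinP; exact: measurable_height.
- by move=> y _; rewrite lee_fin sqrtr_ge0.
apply: eq_integral => y _; rewrite /fubini_G.
transitivity (lebesgue_measure [set t : R | (t ^+ 2 <= 1 - sqnorm y)%R]).
  rewrite -(setIT [set t | _]) -integral_indic//; last first.
    rewrite (_ : [set _ | _] = (fun t : R => t ^+ 2)%R @^-1`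
        [set` `]-oo, (1 - sqnorm y)%R]%R]).
      rewrite -[X in measurable X]setTI.
      suff: measurable_fun [set: R] (fun t : R => t ^+ 2)%R by exact.
      exact: measurable_funX.
    by apply/seteqP; split => t /=; rewrite in_itv.
  apply: eq_integral => t _; rewrite !indicE; congr (_%:R%:E); congr nat_of_bool.
  by apply/idP/idP; rewrite !inE => /BE.
have [y1|y1] := leP (sqnorm y) 1%R; last first.
  rewrite (_ : [set _ | _] = set0) ?measure0.
    by rewrite (_ : height y = 0%R) ?mule0//; apply/eqP; rewrite sqrtr_eq0 subr_le0 ltW.
  apply/seteqP; split => // t /=; have := sqr_ge0 t; lra.
rewrite (_ : [set _ | _] = [set` `[- height y, height y]%R]).
  rewrite lebesgue_measure_itv/= lte_fin -EFinM -EFinB opprK.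
  (* The second case is that of a segment reduced to a point, where [height y = 0]. *)
  case: ifPn => h; first by congr EFin; ring.
  have : (0 <= height y)%R by exact: sqrtr_ge0.
  rewrite -leNgt in h.
  by move=> h0; rewrite (_ : height y = 0%R) ?mulr0//; lra.
apply/seteqP; split => t /=; rewrite in_itv/= -ler_norml -sqrtr_sqr ler_sqrt//;
  by rewrite subr_ge0.
Qed.

Lemma lebesgue_rV_ball_gt0 m :
  0 < lebesgue_rV m.+1 (ellipsoid (fun=> 1%R : R)).
Proof.
(* In the cube of half-side [r = 1 / (m + 1)] each square is at most [r ^+ 2 <= r], so the sum of
   the [m + 1] squares is at most 1. *)
pose r : R := (m.+1%:R^-1)%R.
have r0 : (0 < r)%R by rewrite invr_gt0.
apply: (@lt_le_trans _ _ ((2 * r) ^+ m.+1)%:E).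
  by rewrite lte_fin exprn_gt0// mulr_gt0.
rewrite -lebesgue_rV_cube//; apply: le_measure; rewrite ?inE.
- exact: measurable_cube.
- exact: measurable_ellipsoid.
move=> x /= xr; rewrite /ellipsoid/=.
apply: (@le_trans _ _ (\sum_(i < m.+1) r)%R).
  apply: ler_sum => i _; rewrite expr1n mul1r -real_normK ?num_real//.
  rewrite expr2 -[leRHS]mul1r ler_pM//.
  by rewrite (le_trans (xr i))// invf_le1// ler1n.
by rewrite sumr_const card_ord -mulr_natl mulfV.
Qed.

Lemma lebesgue_rV_ball_lty m :
  lebesgue_rV m.+1 (ellipsoid (fun=> 1%R : R)) < +oo.
Proof.
apply: (@le_lt_trans _ _ ((2 * 1 : R) ^+ m.+1)%:E); last exact: ltry.
rewrite -lebesgue_rV_cube//; apply: le_measure; rewrite ?inE.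
- exact: measurable_ellipsoid.
- exact: measurable_cube.
move=> x /=; rewrite /ellipsoid/= => x1 i.
rewrite -(expr_le1 (n := 2))// real_normK ?num_real//.
apply: le_trans x1; rewrite (bigD1 i)//= expr1n mul1r lerDl.
by apply: sumr_ge0 => j _; rewrite mulr_ge0 ?sqr_ge0.
Qed.

End volume.

(** * The topological boundary of the ellipsoid *)

Section ellipsoid_boundary.
Context {R : realType}.

Lemma quadratic_form_continuous n (q : 'I_n -> R) :
  continuous (fun x : 'rV[R]_n => \sum_i q i ^+ 2 * x 0 i ^+ 2).
Proof.
move=> x; apply: continuous_at_sum => i.
apply: continuousM; first exact: cst_continuous.
apply: (@continuous_comp _ _ _ (fun z : 'rV[R]_n => z 0 i) (fun t => t ^+ 2)).
  exact: coord_continuous.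
exact: exprn_continuous.
Qed.

(** Closedness and the inclusion of [Q < 1] in the interior follow from the continuity of [Q].
    Conversely a point with [Q x = 1] is not interior, because moving outwards along its ray leaves
    the ellipsoid. *)
Lemma boundary_ellipsoid n (q : 'I_n -> R) : boundary (ellipsoid q) = quadric q.
Proof.
pose Q (x : 'rV[R]_n) := \sum_i q i ^+ 2 * x 0 i ^+ 2.
have cQ : continuous Q := @quadratic_form_continuous n q.
have cE : closed (ellipsoid q).
  rewrite (_ : ellipsoid q = Q @^-1` [set x | x <= 1])//.
  by apply: closed_comp => [x _|]; [exact: cQ|exact: closed_le].
have iE : interior (ellipsoid q) = [set x | Q x < 1].
  apply/seteqP; split => [x xE|]; last first.
    rewrite -open_subsetE => [x /= /ltW//|].
    rewrite (_ : [set x | Q x < 1] = Q @^-1` [set x | x < 1])//.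
    by apply: open_comp => [x _|]; [exact: cQ|exact: open_lt].
  have Qx : Q x <= 1 := interior_subset xE.
  rewrite /= lt_neqAle Qx andbT; apply/eqP => Qx1.
  have cx : {for 1, continuous (fun t : R => t *: x)} by exact: scalel_continuous.
  have : nbhs (1 : R) (fun t => ellipsoid q (t *: x)).
    by apply: cx; rewrite scale1r.
  move=> /nbhs_ballP[e /= e0 eE].
  (* At the factor [1 + e / 2] the form takes the value [(1 + e / 2) ^+ 2 > 1]. *)
  have /eE : ball (1 : R) e (1 + e / 2).
    rewrite /ball/= opprD addrA subrr sub0r normrN gtr0_norm; lra.
  rewrite /ellipsoid/=.
  under eq_bigr do rewrite mxE exprMn mulrCA.
  by rewrite -mulr_sumr -/(Q x) Qx1 mulr1 => ?; nra.
rewrite /boundary -(closure_id _).1// iE; apply/seteqP; split => x /=.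
  by move=> [xE /negP]; rewrite -leNgt => ?; apply/eqP; rewrite eq_le; apply/andP.
by move=> xq; rewrite /Q /ellipsoid/= xq lexx ltxx; split.
Qed.

Lemma unit_sphereE n : unit_sphere n = quadric (fun _ : 'I_n => 1 : R).
Proof.
apply/seteqP; split => x; rewrite /unit_sphere /quadric /=;
  by under [in X in _ -> X]eq_bigr do rewrite ?expr1n ?mul1r;
  under eq_bigr do rewrite ?expr1n ?mul1r.
Qed.

End ellipsoid_boundary.

(** * Areas of the sphere and of the ellipsoid *)

Section area_formulas.
Context {R : realType} (m : nat).

Lemma chart_one (s : R) : chart (fun=> 1) ord0 s = @hemisphere R m ord0 s.
Proof. by apply/funext => y; apply/rowP => j; rewrite mxE invr1 mul1r. Qed.

(** Over the ball the sum under the root is 1, since the chart lands on the unit sphere; elsewhere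
    both sides are 0. *)
Lemma chart_density_one (s : R) (y : 'rV[R]_m) : s ^+ 2 = 1 ->
  chart_density (fun=> 1) ord0 s y = (height y)^-1.
Proof.
move=> s1; rewrite /chart_density big1// invr1 mul1r.
have [y1|y1] := ltP (sqnorm y) 1; last first.
  rewrite (_ : height y = 0) ?invr0 ?mulr0//.
  by apply/eqP; rewrite sqrtr_eq0 subr_le0.
have := @quadric_chart R m (fun=> 1) ord0 s (fun=> ltr01) s1 y y1.
by rewrite /quadric chart_one/= => ->; rewrite sqrtr1 mul1r.
Qed.

(** Each hemisphere has area the integral of [1 / height], that is [m.+1] times the integral of
    [height], which is half the volume of the ball. *)
Lemma sphere_area (sigma : {measure set 'rV[R]_m.+1 -> \bar R}) :
  is_surface_measure m (unit_sphere m.+1) sigma ->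
  (sigma (unit_sphere m.+1) =
   m.+1%:R%:E * lebesgue_rV m.+1 (ellipsoid (fun=> 1%R)))%E.
Proof.
rewrite unit_sphereE => hs.
have -> : (sigma (quadric (fun=> 1%R)) =
    \int[sigma]_(x in quadric (fun=> 1%R)) cst 1 x)%E.
  by rewrite integral_cst ?mul1e//; exact: measurable_quadric.
rewrite (surface_integral (fun=> ltr01) hs)//.
under eq_integral do rewrite mul1e chart_density_one ?expr1n//.
under [X in (_ + X)%E]eq_integral do
  rewrite mul1e chart_density_one ?sqrrN ?expr1n//.
by rewrite integral_inv_height lebesgue_rV_ball muleCA [RHS]mule_natl mule2n.
Qed.

Lemma ellipsoid_area (q : 'I_m.+1 -> R)
    (sigma area : {measure set 'rV[R]_m.+1 -> \bar R}) :
  (forall j, 0 < q j) ->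
  is_surface_measure m (unit_sphere m.+1) sigma ->
  is_surface_measure m (quadric q) area ->
  (area (quadric q) = ((\prod_j q j)^-1)%:E *
   \int[sigma]_(u in unit_sphere m.+1)
     (Num.sqrt (\sum_i u 0%R i ^+ 2 * q i ^+ 2)%R)%:E)%E.
Proof.
rewrite unit_sphereE => q0 hs ha.
set f := fun u : 'rV[R]_m.+1 => Num.sqrt (\sum_i u 0 i ^+ 2 * q i ^+ 2).
have fE : f = fun u => Num.sqrt (\sum_i q i ^+ 2 * u 0 i ^+ 2).
  by apply/funext => u; congr Num.sqrt; apply: eq_bigr => i _; rewrite mulrC.
have mf : measurable_fun [set: 'rV[R]_m.+1] f.
  rewrite fE; apply: (measurableT_comp measurable_sqrtr).
  exact: measurable_quadratic_form.
have P0 : 0 <= (\prod_j q j)^-1.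
  by rewrite invr_ge0; apply: prodr_ge0 => j _; exact: ltW.
have -> : (area (quadric q) = \int[area]_(x in quadric q) cst 1 x)%E.
  by rewrite integral_cst ?mul1e//; exact: measurable_quadric.
rewrite (surface_integral q0 ha)// (surface_integral (fun=> ltr01) hs); last 2 first.
- exact/measurable_EFinP.
- by move=> u; rewrite lee_fin sqrtr_ge0.
(* The sphere and the ellipsoid share the parameter [y], and their densities differ by the factor
   [(\prod_j q j)^-1] times [f] at the point of the sphere above [y]. *)
have half s : s ^+ 2 = 1 ->
    (\int[lebesgue_rV m]_y (cst 1 (chart q ord0 s y) *
      (chart_density q ord0 s y)%:E) =
    ((\prod_j q j)^-1)%:E * \int[lebesgue_rV m]_y
      ((f (chart (fun=> 1%R) ord0 s y))%:E *
      (chart_density (fun=> 1%R) ord0 s y)%:E))%E.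
  move=> s1; rewrite -ge0_integralZl//; last 2 first.
  - apply: emeasurable_funM; apply/measurable_EFinP.
      by apply: measurableT_comp => //; exact: measurable_chart.
    exact: measurable_chart_density.
  - move=> y _; rewrite mule_ge0// lee_fin ?sqrtr_ge0//.
    exact: chart_density_ge0.
  apply: eq_integral => y _; rewrite mul1e -!EFinM; congr EFin.
  by rewrite chart_density_one// chart_one /chart_density fE mulrA.
rewrite !half ?sqrrN ?expr1n// -ge0_muleDr//.
  apply: integral_ge0 => y _; rewrite mule_ge0// lee_fin ?sqrtr_ge0//.
  exact: chart_density_ge0.
apply: integral_ge0 => y _; rewrite mule_ge0// lee_fin ?sqrtr_ge0//.
exact: chart_density_ge0.
Qed.

End area_formulas.

(** * The ratio of area to volume *)

Theorem mainTheorem1 (R : realType) (n : nat) (hn : (2 <= n)%N)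
    (q : 'I_n -> R) (hq : forall i : 'I_n, 0 < q i)
    (sigma : {measure set 'rV[R]_n -> \bar R})
    (hsigma : is_surface_measure n.-1 (unit_sphere n) sigma)
    (area : {measure set 'rV[R]_n -> \bar R})
    (harea : is_surface_measure n.-1 (boundary (ellipsoid q)) area) :
  (area (boundary (ellipsoid q)) / lebesgue_rV n (ellipsoid q) =
   n%:R%:E * (1 / sigma (unit_sphere n) *
     \int[sigma]_(u in unit_sphere n)
       (Num.sqrt (\sum_(i < n) u 0%R i ^+ 2 * q i ^+ 2)%R)%:E))%E.
Proof.
case: n hn q hq sigma hsigma area harea => [//|m] _ q q0 sigma hsigma area.
rewrite boundary_ellipsoid => harea.
rewrite (ellipsoid_area q0 hsigma harea) (sphere_area hsigma).
rewrite lebesgue_rV_ellipsoid//.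
have P0 : \prod_j q j != 0 by apply/prodf_neq0 => j _; rewrite gt_eqF.
have := @lebesgue_rV_ball_gt0 R m; have := @lebesgue_rV_ball_lty R m.
(* The volume of the ball is a positive real [v], so the divisions can be carried out in the
   reals. *)
case: (lebesgue_rV m.+1 _) => [v _|//|//]; rewrite lte_fin => v0.
have v0' : v != 0 by rewrite gt_eqF.
have n0 : m.+1%:R != 0 :> R by rewrite pnatr_eq0.
(* The integral stays an arbitrary extended real, as only its real coefficients are to be compared:
   the product of the [q j] cancels on the left, [m.+1] on the right, leaving [v^-1] on both
   sides. *)
move: (integral _ _ _) => I.
rewrite -!EFinM !inver !mulf_eq0 invr_eq0 (negPf P0) (negPf v0') (negPf n0)/=.
rewrite mul1e muleAC muleA -!EFinM; congr (_%:E * I)%E.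
by rewrite !invfM invrK !mulrA mulVf// divff// !mul1r.
Qed.
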